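(* Let $W$ be a right-angled Coxeter group (of arbitrary, possibly infinite, rank) with Coxeter basis $S$, and let $\Gamma_W$ be its Coxeter graph. Suppose that: (a) $\Gamma_W$ is star-connected; (b) $\Gamma_W$ is triangle-free; (c) $\Gamma_W$ contains, as a (not necessarily induced) subgraph, a path $P_4$ on four distinct vertices $a,b,c,d$ with $a E b$, $b E c$, $c E d$. Then $\mathrm{Spe}(W)=\mathrm{Inn}(W)$.
   Context: A Coxeter system $(W,S)$ is right-angled if $W$ has the presentation with generating set $S$ and relations $s^2=e$ for $s\in S$ and $(ss')^2=e$ for some set of pairs of distinct $s,s'\in S$ (all other pairs of distinct generators satisfy no relation). $S$ is called a Coxeter basis. The Coxeter graph $\Gamma_W=\Gamma_{(W,S)}$ has vertex set $S$, with distinct $s,s'$ adjacent ($sEs'$) iff $(ss')^2=e$, i.e. iff $s,s'$ commute. For a vertex $v$ of a graph, $N(v)$ is the set of neighbours of $v$ and $st(v)=N(v)\cup\{v\}$. A graph $\Gamma$ is star-connected if for every vertex $v$ the induced subgraph $\Gamma-st(v)$ is connected. $\mathrm{Spe}(W)$ denotes the group of automorphisms $\alpha$ of $W$ such that $\alpha(s)$ is conjugate to $s$ for every $s\in S$; $\mathrm{Inn}(W)$ is the group of inner automorphisms. *)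

(* Defs.v *)
From Stdlib Require Export Relation_Operators.
From mathcomp Require Export all_boot monoid boolp classical_sets.

Set Implicit Arguments.
Unset Strict Implicit.
Unset Printing Implicit Defensive.

Local Open Scope group_scope.
Local Open Scope classical_set_scope.

(* A letter (x, true) stands for x, and (x, false) for its formal inverse. *)
Definition gword (X : Type) := seq (X * bool).

(* Equality, in the group with generators X and relators Rel, of the elements
   represented by two words: Rel contains words that are to be trivial. *)
Inductive pres_eq (X : Type) (Rel : set (gword X)) : gword X -> gword X -> Prop :=
| pres_refl u : pres_eq Rel u u
| pres_sym u v : pres_eq Rel u v -> pres_eq Rel v u
| pres_trans u v w : pres_eq Rel u v -> pres_eq Rel v w -> pres_eq Rel u w
| pres_cancel u v x b :
    pres_eq Rel (u ++ [:: (x, b); (x, ~~ b)] ++ v) (u ++ v)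
| pres_relator u v r : Rel r -> pres_eq Rel (u ++ r ++ v) (u ++ v).

Definition eval_word (W : groupType) (X : Type) (f : X -> W) (w : gword X) : W :=
  foldr (fun l g => (if l.2 then f l.1 else (f l.1)^-1) * g) 1 w.

(* W = < S | Rel >: evaluation induces an isomorphism onto W from the group of
   words modulo pres_eq Rel. *)
Definition has_presentation (W : groupType) (S : set W) (Rel : set (gword S)) :=
  (forall g : W, exists w : gword S, eval_word val w = g) /\
  (forall u v : gword S, eval_word val u = eval_word val v <-> pres_eq Rel u v).

Definition racg_relators (X : Type) (C : X -> X -> Prop) : set (gword X) :=
  [set r | (exists s, r = [:: (s, true); (s, true)]) \/
           (exists s t, C s t /\
              r = [:: (s, true); (t, true); (s, true); (t, true)])].

Definition right_angled_Coxeter_system (W : groupType) (S : set W) :=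
  exists C : S -> S -> Prop,
    (forall s t, C s t -> s <> t) /\ has_presentation (racg_relators C).

Definition Coxeter_graph (W : groupType) (S : set W) (s t : S) : Prop :=
  s <> t /\ (val s * val t) ^+ 2 = 1.

(* A simple graph is given by its vertex type V and adjacency relation E. *)

Definition star (V : Type) (E : V -> V -> Prop) (v : V) : set V :=
  [set u | E v u] `|` [set v].

Definition induced (V : Type) (E : V -> V -> Prop) (A : set V) (x y : A) : Prop :=
  E (val x) (val y).

(* The graph with no vertex counts as connected. *)
Definition graph_connected (V : Type) (E : V -> V -> Prop) :=
  forall x y, clos_refl_trans V E x y.

Definition star_connected (V : Type) (E : V -> V -> Prop) :=
  forall v : V, graph_connected (@induced V E (~` star E v)).

Definition triangle_free (V : Type) (E : V -> V -> Prop) :=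
  ~ exists x y z, [/\ E x y, E y z & E x z].

Definition contains_P4 (V : Type) (E : V -> V -> Prop) :=
  exists a b c d,
    [/\ a <> b, a <> c & a <> d] /\ [/\ b <> c, b <> d & c <> d] /\
    [/\ E a b, E b c & E c d].

Definition is_automorphism (W : groupType) (f : W -> W) :=
  bijective f /\ {morph f : x y / x * y}.

Definition Spe (W : groupType) (S : set W) : set (W -> W) :=
  [set f | is_automorphism f /\
           forall s, S s -> exists g : W, f s = s ^ g].

Definition Inn (W : groupType) : set (W -> W) :=
  [set f | exists g : W, f = (fun x : W => x ^ g : W)].
Arguments Inn W : clear implicits.

(* Main.v *)
(* Regard the elements of [W] as chambers and each reflection as a wall.
   A special automorphism [al] sends every generator [s] to a reflection
   [rho s], and the walls of [rho s], [rho t] cross or are disjoint according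
   to whether [s], [t] commute.  Star-connectedness yields for every [v] a
   half-space bounded by the wall of [rho v] that contains the walls of all
   [rho u] with [u] outside the star of [v].  By triangle-freeness these
   half-spaces have a common chamber [y], next to the crossing of the walls of
   an edge of the graph.  A ping-pong argument and the surjectivity of [al]
   show that [y] is the only common chamber, so the walls of [y] are those of
   the [rho s], and [al] is the conjugation by [y^-1]. *)

Require Import Defs.
From mathcomp Require Import all_boot monoid boolp classical_sets.
From mathcomp Require Import ssralg ssrnum ssrint zify.

Set Implicit Arguments.
Unset Strict Implicit.
Unset Printing Implicit Defensive.

Local Open Scope group_scope.
Local Open Scope classical_set_scope.

Section RightAngledCoxeterGroup.

Context (W : groupType) (S : set W) (C : S -> S -> Prop).
Context (C_neq : forall s t, C s t -> s <> t).
Context (presW : has_presentation (racg_relators C)).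

Implicit Types (r g h x y : W) (s t u v : S) (w : seq S).

(** * Relations between generators, and actions of [W] from its presentation *)

Lemma gen_sq s : val s * val s = 1.
Proof.
have /(iffRL (presW.2 _ _)) : pres_eq (racg_relators C)
    [:: (s, true); (s, true)] [::].
  by apply: (@pres_relator _ _ [::] [::] [:: _; _]); left; exists s.
by rewrite /eval_word /= mulg1.
Qed.

Lemma gen_inv s : (val s)^-1 = val s.
Proof. exact/mulg1_eq/gen_sq. Qed.

Lemma gen_commuteP s t :
  commute (val s) (val t) <-> (val s * val t) ^+ 2 = 1.
Proof.
rewrite expgS expg1; split=> [cst|/mulg1_eq].
  by rewrite {1}cst mulgA -(mulgA (val t)) gen_sq mulg1 gen_sq.
by rewrite invgM !gen_inv.
Qed.

Lemma relator_commute s t : C s t -> commute (val s) (val t).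
Proof.
move=> Cst; apply/gen_commuteP.
have /(iffRL (presW.2 _ _)) : pres_eq (racg_relators C)
    [:: (s, true); (t, true); (s, true); (t, true)] [::].
  by apply: (@pres_relator _ _ [::] [::] [:: _; _; _; _]); right; exists s, t.
by rewrite /eval_word /= mulg1 expgS expg1 !mulgA.
Qed.

Lemma universal_action (X : Type) (f : S -> X -> X) :
    (forall s a, f s (f s a) = a) ->
    (forall s t a, C s t -> f s (f t a) = f t (f s a)) ->
  exists F : W -> X -> X,
    [/\ forall a, F 1 a = a,
        forall g h a, F (g * h) a = F g (F h a) &
        forall s a, F (val s) a = f s a].
Proof.
move=> fK fC.
pose run (w : gword S) a := foldr (fun l => f l.1) a w.
have run_cat p q a : run (p ++ q) a = run p (run q a) by rewrite /run foldr_cat.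
have run_pres p q : pres_eq (racg_relators C) p q -> run p =1 run q.
  elim=> {p q} [//|p q _ IH a|p q k _ IH1 _ IH2 a|p q s b a|p q k Rk a].
  - by rewrite IH.
  - by rewrite IH1 IH2.
  - by rewrite !run_cat /= fK.
  - rewrite !run_cat; congr (run p _).
    by case: Rk => [[s ->]|[s [t [Cst ->]]]] /=; rewrite ?fK // (fC _ _ _ Cst) !fK.
have [wd wdE] := choice presW.1.
exists (fun g => run (wd g)); split=> [a|g h a|s a].
- by rewrite (run_pres _ [::]) //; apply/presW.2; rewrite wdE.
- rewrite -run_cat; apply: run_pres; apply/presW.2.
  rewrite wdE -{1}(wdE g) -{1}(wdE h).
  elim: (wd g) => [|l p IH] /=; first by rewrite mul1g.
  by rewrite -mulgA IH.
- rewrite (run_pres _ [:: (s, true)]) //; apply/presW.2.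
  by rewrite wdE /eval_word /= mulg1.
Qed.

(** The parity of the number of letters [s] defines an action on [bool], and it is invariant under
    conjugation. *)
Lemma gen_conj_eq s t g : val s ^ g = val t -> s = t.
Proof.
move=> st; apply: contrapT => nst.
have [||F [F1 FM Fg]] := @universal_action bool (fun u b => (u == s) (+) b).
- by move=> u b; rewrite addKb.
- by move=> u v b _; rewrite addbCA.
have := Fg t true; rewrite -st conjgE !FM Fg eqxx.
case: (t =P s) nst => [->//|_ _] /= /(congr1 (F g)).
rewrite -FM mulgV F1.
by case: (F g true).
Qed.

(** * Words, reflections and separating walls *)

Definition ev w : W := foldr (fun s g => val s * g) 1 w.

Lemma ev_cat w1 w2 : ev (w1 ++ w2) = ev w1 * ev w2.
Proof. by elim: w1 => [|s w1 IH] /=; rewrite ?mul1g // IH mulgA. Qed.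

Lemma ev_surj g : exists w, ev w = g.
Proof.
have [p <-] := presW.1 g; exists (map fst p).
elim: p => [//|[s b] p IH] /=; rewrite IH /eval_word /=.
by case: b; rewrite ?gen_inv.
Qed.

(** Tits' signed action: [val s] conjugates the first component and flips the sign exactly when that
    component is [val s]. The sign accumulated from [false] is the cocycle. *)
Lemma cocycle_exists : exists eta : W -> W -> bool,
  (forall r x y, eta r (x * y) = eta r x (+) eta (r ^ x) y) /\
  (forall r s, eta r (val s) = (r == val s)).
Proof.
pose f s (p : W * bool) := (p.1 ^ val s, p.2 (+) (p.1 == val s)).
have fixE s t r : commute (val s) (val t) -> (r ^ val s == val t) = (r == val t).
  move=> cst; rewrite -{1}(_ : val t ^ val s = val t).
    exact/(inj_eq (conjg_inj _)).
  by rewrite conjgE -cst mulKg.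
have [||F [F1 FM Fg]] := @universal_action (W * bool)%type f.
- move=> s [r b]; rewrite /f /= -conjgM gen_sq conjg1.
  by rewrite fixE // -addbA addbb addbF.
- move=> s t [r b] /relator_commute cst; rewrite /f /= -!conjgM cst.
  by rewrite !fixE // addbAC.
have FE g r b : F g (r, b) = (r ^ g^-1, b (+) (F g (r, false)).2).
  have [w <-] := ev_surj g; elim: w r b => [|s w IH] r b /=.
    by rewrite !F1 invg1 conjg1 addbF.
  by rewrite !FM !Fg IH [F _ (r, false)]IH /f /= invgM conjgM gen_inv addbA.
(* [F] is a left action and [r ^ x] a right one, hence the inverse. *)
exists (fun r x => (F x^-1 (r, false)).2); split=> [r x y|r s].
  by rewrite invgM FM (FE x^-1) (FE _ _ (_ (+) _)) /= invgK.
by rewrite gen_inv Fg.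
Qed.

(* [eta r x] says whether the wall of the reflection [r] separates the
   chambers [1] and [x]; it is [false] when [r] is not a reflection. *)
Definition eta : W -> W -> bool := sval (cid cocycle_exists).

Lemma etaM r x y : eta r (x * y) = eta r x (+) eta (r ^ x) y.
Proof. exact: (svalP (cid cocycle_exists)).1. Qed.

Lemma eta_gen r s : eta r (val s) = (r == val s).
Proof. exact: (svalP (cid cocycle_exists)).2. Qed.

Lemma eta1 r : eta r 1 = false.
Proof. by have := etaM r 1 1; rewrite mulg1 conjg1 addbb. Qed.

Lemma eta_gen_mul s x : eta (val s) (val s * x) = ~~ eta (val s) x.
Proof. by rewrite etaM eta_gen eqxx conjgE mulKg. Qed.

(** The contributions of [g^-1] and [g] cancel because [val s] fixes [r ^ g^-1]; only the middle
    letter counts. *)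
Lemma eta_commute_refl r g s : commute r (val s ^ g) ->
  eta r (val s ^ g) = (r == val s ^ g).
Proof.
move=> cr; set q := r ^ g^-1.
have qs : q ^ val s = q.
  by apply: (conjg_inj g); rewrite conjJg conjgKV conjgE cr mulKg.
rewrite conjgE !etaM -/q eta_gen qs addbCA -etaM mulVg eta1 addbF.
by rewrite (can2_eq (conjgKV g) (conjgK g)).
Qed.

Lemma eta_refl_mul s g x :
  eta (val s ^ g) (val s ^ g * x) = ~~ eta (val s ^ g) x.
Proof.
by rewrite etaM eta_commute_refl // eqxx addTb [_ ^ (_ ^ g)]conjgE mulKg.
Qed.

(** * Exchange and left descents *)

Lemma crossing r w : eta r (ev w) ->
  exists w1 s w2, w = w1 ++ s :: w2 /\ r ^ ev w1 = val s.
Proof.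
elim: w r => [|s w IH] r /=; first by rewrite eta1.
rewrite etaM eta_gen; case: eqP => [rs _|_] /=.
  by exists [::], s, w; rewrite conjg1.
move=> /IH [w1 [t [w2 [-> h]]]]; exists (s :: w1), t, w2.
by rewrite /= conjgM.
Qed.

Lemma exchange s w : eta (val s) (ev w) ->
  exists w1 t w2, [/\ w = w1 ++ t :: w2, val s * ev w1 = ev w1 * val t &
    val s * ev w = ev (w1 ++ w2)].
Proof.
move=> /crossing [w1 [t [w2 [-> st]]]]; exists w1, t, w2.
have c : val s * ev w1 = ev w1 * val t by rewrite -st -conjgC.
split=> //; rewrite !ev_cat /= mulgA c -(mulgA _ (val t)).
by rewrite (mulgA (val t)) gen_sq mul1g.
Qed.

(** Induction on word length: if [s] is not a left descent of [val s * ev w], it is one of [ev w],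
    and exchange gives a word two letters shorter than [s :: w]. *)
Lemma descent_ind (P : W -> Prop) : P 1 ->
    (forall s x, eta (val s) (val s * x) -> P x -> P (val s * x)) ->
  forall x, P x.
Proof.
move=> P1 Pm x; have [w <-] := ev_surj x.
have [n] := ubnP (size w); elim: n w => // n IH [|s w] //=.
rewrite ltnS => wn; case: (boolP (eta (val s) (val s * ev w))) => [h|].
  by apply: Pm => //; apply: IH.
rewrite eta_gen_mul negbK => /exchange [w1 [t [w2 [wE _ ->]]]].
apply: IH; apply: leq_trans wn.
by rewrite wE !size_cat /= addnS ltnS leqW.
Qed.

Fixpoint alt s t k := if k is k'.+1 then s :: alt t s k' else [::].

Lemma size_alt s t k : size (alt s t k) = k.
Proof. by elim: k s t => //= k IH s t; rewrite IH. Qed.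

Lemma alt_prefix s t k w1 u w2 : alt s t k = w1 ++ u :: w2 ->
  exists i, rcons w1 u = alt s t i.+1 /\ w1 = alt s t i.
Proof.
elim: k s t w1 => [|k IH] s t [|v w1] //= [] => [<- _|<- /IH [i /= [e1 e2]]].
  by exists 0.
by exists i.+1; rewrite /= e1 -e2.
Qed.

(* The two alternating words are separated by the action of the infinite
   dihedral group on the integers in which [s], [t] act as the reflections
   [z |-> - z] and [z |-> 1 - z]. *)
Lemma alt_neq s t k : ~ commute (val s) (val t) ->
  ev (alt s t k.+1) <> ev (alt t s k.+1).
Proof.
move=> ncst.
have nst : s <> t by move=> st; apply: ncst; rewrite st.
pose f u (z : int) : int :=
  if u == s then (- z)%R else if u == t then (1 - z)%R else z.
have fs z : f s z = (- z)%R by rewrite /f eqxx.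
have ft z : f t z = (1 - z)%R.
  by rewrite /f; case: (t =P s) nst => [->|]; rewrite ?eqxx.
have [||F [F1 FM Fg]] := @universal_action int f.
- by move=> u z; rewrite /f; case: (u == s); case: (u == t); lia.
- move=> u v z /[dup] /C_neq uv /relator_commute cuv; rewrite /f.
  case: (u =P s) => us; case: (v =P s) => vs //; case: (u =P t) => ut;
    case: (v =P t) => vt //; subst => //; by case: ncst.
have bnd n : ((F (ev (alt s t n)) 0 <= 0) && (0 <= F (ev (alt t s n)) 0))%R.
  elim: n => [|n IH] /=; first by rewrite F1.
  by rewrite !FM !Fg fs ft; lia.
move=> /(congr1 (F^~ 0%R)) /=.
by have := bnd k; rewrite !FM !Fg fs ft; lia.
Qed.

(* By exchange, an element with both [s] and [t] as left descents would have
   words of one fixed length beginning with arbitrarily long alternating ones. *)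
Lemma descents_commute s t x :
  eta (val s) x -> eta (val t) x -> commute (val s) (val t).
Proof.
move=> sx tx; apply: contrapT => ncst.
have [w wx] := ev_surj x; set n := size w.
suff /(_ n.+1) [v vx vn] : forall k, exists2 w', ev (alt s t k ++ w') = x &
    size (alt s t k ++ w') = n.
  by move: vn; rewrite size_cat size_alt; lia.
move=> k; elim: k s t sx tx ncst => [|k IH] s t sx tx ncst; first by exists w.
have ncts : ~ commute (val t) (val s) by move=> /commute_sym.
have [v vx vn] := IH t s tx sx ncts.
move: sx; rewrite -vx => /exchange [w1 [u [w2 [wE c del]]]].
(* A letter deleted inside the alternating prefix would equate two alternating words, contrary to
   [alt_neq]; so the prefix survives and gains a letter. *)
case: (ltnP (size w1) k) => w1k.
  have : alt t s k = w1 ++ u :: take (k - (size w1).+1) w2.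
    have := congr1 (take k) wE.
    rewrite take_size_cat ?size_alt // => ->.
    rewrite take_cat ltnNge ltnW //=.
    by have -> : k - size w1 = (k - (size w1).+1).+1 by lia.
  move=> /alt_prefix [i [e1 e2]].
  have := @alt_neq s t i ncst; case.
  by rewrite -e1 -cats1 ev_cat /= mulg1 -c e2.
have [w3 w1E] : exists w3, w1 = alt t s k ++ w3.
  exists (drop k w1); have := congr1 (take k) wE.
  by rewrite take_size_cat ?size_alt // takel_cat // => ->; rewrite cat_take_drop.
exists (w3 ++ w2).
  by rewrite /= catA -w1E -del vx mulgA gen_sq mul1g.
by rewrite -vn wE w1E /= !size_cat /=; lia.
Qed.

(** * Centralizers and galleries along walls *)

Lemma centralizer_gen t x : commute x (val t) ->
  exists2 w, ev w = x & forall u, u \in w -> commute (val u) (val t).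
Proof.
elim/descent_ind: x => [_|u x ux IH cx]; first by exists [::].
have [cut|ncut] := pselect (commute (val u) (val t)).
  have [|w wx wt] := IH.
    have := commuteM (commute_sym cut) (commute_sym cx).
    by rewrite mulgA gen_sq mul1g => /commute_sym.
  exists (u :: w) => [|v]; first by rewrite /= wx.
  by rewrite inE => /orP [/eqP ->|/wt].
set y := val u * x in ux cx *.
(* [u] is a left descent of both [y] and [val t * y], while [t] is one of exactly one of them; so
   [u] and [t] would commute. *)
have uty : eta (val u) (val t * y).
  rewrite -cx etaM ux eta_gen; case: eqP => // uy; case: ncut.
  have -> : val u = val t; last by [].
  by apply: (conjg_inj y); rewrite uy conjgE -cx mulKg.
have [ty|/negPf nty] := boolP (eta (val t) y).
  by case: ncut; apply: descents_commute ux ty.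
by case: ncut; apply: descents_commute uty _; rewrite eta_gen_mul nty.
Qed.

Lemma commute_conj g x y : commute (x ^ g) (y ^ g) <-> commute x y.
Proof.
by split=> [|c]; rewrite /commute -!conjMg; [move/conjg_inj | rewrite c].
Qed.

Lemma commute_conjg x y : commute x y -> x ^ y = x.
Proof. by move=> c; rewrite conjgE c mulKg. Qed.

(* A chamber [x] lies along the wall of the reflection [r] of type [t] when
   [r ^ x = val t].  By [centralizer_gen] any two such chambers are joined by
   a gallery that only crosses walls of reflections commuting with [r]. *)
Lemma wall_one_side r q t x y : r ^ x = val t -> r ^ y = val t ->
  ~ commute q r -> eta q x = eta q y.
Proof.
move=> rx ry ncqr.
have : commute (x^-1 * y) (val t).
  by rewrite /commute [RHS]conjgC -{2}rx -conjgM mulVKg ry.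
move=> /centralizer_gen [w wxy wt].
have {wxy} -> : y = x * ev w by rewrite wxy mulVKg.
elim: w x rx wt {y ry} => [|u w IH] x rx wt; first by rewrite mulg1.
have cut : commute (val u) (val t) by apply: wt; rewrite inE eqxx.
rewrite /= mulgA -IH.
- rewrite etaM eta_gen; case: eqP => [qx|_]; last by rewrite addbF.
  by case: ncqr; apply/(commute_conj x); rewrite qx rx.
- by rewrite conjgM rx commute_conjg //; apply: commute_sym.
- by move=> v vw; apply: wt; rewrite inE vw orbT.
Qed.

(** Conjugation turns the first reflection into [val s], and the second into a product of generators
    commuting with [val s]. This gallery crosses the second wall, and the chamber just before that
    crossing lies along both walls. *)
Lemma commuting_walls_meet s t g h : commute (val s ^ g) (val t ^ h) ->
  exists x, (val s ^ g) ^ x = val s /\ (val t ^ h) ^ x = val t.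
Proof.
set r := val s ^ g; set q := val t ^ h => crq.
have rg : r ^ g^-1 = val s by rewrite conjgK.
have qE : q ^ g^-1 = val t ^ (h * g^-1) by rewrite conjgM.
have /centralizer_gen [w wq ws] : commute (q ^ g^-1) (val s).
  by rewrite -rg commute_conj; apply: commute_sym.
have : eta (q ^ g^-1) (ev w) by rewrite wq qE eta_commute_refl ?eqxx.
move=> /crossing [w1 [u [w2 [wE qu]]]].
exists (g^-1 * ev w1); rewrite !conjgM qu rg; split.
  apply: commute_conjg.
  have : forall v, v \in w1 -> commute (val v) (val s).
    by move=> v vw; apply: ws; rewrite wE mem_cat vw.
  elim: (w1) => [|v w' IH] cw; first exact: commute1.
  apply: commuteM.
    by apply/commute_sym/cw; rewrite inE eqxx.
  by apply: IH => v' v'w; apply: cw; rewrite inE v'w orbT.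
congr val; apply/esym/(@gen_conj_eq _ _ (h * g^-1 * ev w1)).
by rewrite conjgM -qE.
Qed.

(** * Walls of the images of the generators *)

Section SpecialAutomorphism.

Context (al : W -> W) (alM : {morph al : x y / x * y}) (al_bij : bijective al).
Context (al_conj : forall s, exists g, al (val s) = val s ^ g).
Context (star_conn : star_connected (@Coxeter_graph W S)).
Context (tri_free : triangle_free (@Coxeter_graph W S)).

Local Notation E := (@Coxeter_graph W S).
Local Notation rho s := (al (val s)).

Definition along s x := (rho s) ^ x = val s.

Lemma al1 : al 1 = 1.
Proof. by apply: (mulgI (al 1)); rewrite -alM !mulg1. Qed.

Lemma commute_al x y : commute (al x) (al y) <-> commute x y.
Proof.
by split=> [|c]; rewrite /commute -!alM; [move/(bij_inj al_bij) | rewrite c].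
Qed.

Lemma adjE s t : E s t <-> s <> t /\ commute (val s) (val t).
Proof. by rewrite /Coxeter_graph gen_commuteP. Qed.

Lemma not_in_star s t : ~ star E s t <-> ~ commute (val s) (val t).
Proof.
split=> [nst c|nc [/adjE []//|/= st]]; last by apply: nc; rewrite st.
apply: nst; have [->|nst] := pselect (t = s); first by right.
by left; apply/adjE; split=> // st; apply: nst.
Qed.

Lemma along_exists s : exists x, along s x.
Proof. by have [g sg] := al_conj s; exists g^-1; rewrite /along sg conjgK. Qed.

Lemma eta_rho s x : eta (rho s) (rho s * x) = ~~ eta (rho s) x.
Proof. by have [g ->] := al_conj s; rewrite eta_refl_mul. Qed.

Lemma along_side u v x y : ~ commute (val u) (val v) ->
  along v x -> along v y -> eta (rho u) x = eta (rho u) y.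
Proof. by move=> nc vx vy; apply: wall_one_side vx vy _; rewrite commute_al. Qed.

Lemma along_both u v : commute (val u) (val v) ->
  exists x, along u x /\ along v x.
Proof.
rewrite -commute_al /along.
by have [g ->] := al_conj u; have [h ->] := al_conj v; exact: commuting_walls_meet.
Qed.

(* Walls disjoint from that of [rho v] lie on the same side of it if they
   cross, so star-connectedness puts all of them on one side. *)
Lemma side_exists v : exists e : bool, forall u x,
  ~ commute (val v) (val u) -> along u x -> eta (rho v) x = e.
Proof.
have [[u0 nc0]|none] := pselect (exists u, ~ commute (val v) (val u)); last first.
  by exists false => u x nc; case: none; exists u.
have [x0 ux0] := along_exists u0.
exists (eta (rho v) x0) => u x nc ux.
have mem t : ~ commute (val v) (val t) -> t \in ~` star E v.
  by move=> nct; rewrite inE; apply/not_in_star.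
have nmem (p : ~` star E v) : ~ commute (val v) (val (val p)).
  by apply/not_in_star; exact: (set_valP p).
have main (p q : ~` star E v) : clos_refl_trans _ (@induced _ E _) p q ->
    forall x y, along (val p) x -> along (val q) y ->
      eta (rho v) x = eta (rho v) y.
  elim=> {p q} [p q /adjE [_ cpq]|p|p q k _ IH1 _ IH2] a b pa qb.
  - have [z [pz qz]] := along_both cpq.
    by rewrite (along_side _ pa pz) ?(along_side _ qz qb).
  - by rewrite (along_side _ pa qb).
  - have [z qz] := along_exists (val q).
    by rewrite (IH1 _ z) // (IH2 _ b).
pose p : ~` star E v := exist _ u (mem _ nc).
pose p0 : ~` star E v := exist _ u0 (mem _ nc0).
exact: (main p p0 (star_conn p p0)).
Qed.

Definition side v : bool := sval (cid (side_exists v)).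

Lemma sideP v u x : ~ commute (val v) (val u) -> along u x ->
  eta (rho v) x = side v.
Proof. exact: (svalP (cid (side_exists v))). Qed.

(* [y] lies in the intersection of the half-spaces bounded by the walls of the
   [rho v] that contain all the walls disjoint from them. *)
Definition inner_chamber y := forall v, eta (rho v) y = side v.

Lemma along_mul s t x : commute (val s) (val t) -> along s x ->
  along s (x * val t).
Proof. by move=> c sx; rewrite /along conjgM sx commute_conjg. Qed.

(* Of the four chambers where the walls of an edge [b], [c] meet, one is on the
   right sides of these two walls, and hence of all others: as no [v] is
   adjacent to both [b] and [c], the wall of [v] misses that of [b] or [c]. *)
Lemma inner_chamber_exists : (exists b c, E b c) -> exists y, inner_chamber y.
Proof.
move=> [b [c bc]]; have [nbc cbc] := (adjE b c).1 bc.
have ccb := commute_sym cbc.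
suff [y [bY cY sb sc]] : exists y, [/\ along b y, along c y,
    eta (rho b) y = side b & eta (rho c) y = side c].
  exists y => v.
  have [->//|nvb] := pselect (v = b); have [->//|nvc] := pselect (v = c).
  have [cvb|ncvb] := pselect (commute (val v) (val b)); last exact: sideP ncvb bY.
  have [cvc|ncvc] := pselect (commute (val v) (val c)); last exact: sideP ncvc cY.
  by case: tri_free; exists v, b, c; split; rewrite ?adjE.
have flip s t x : along s x ->
    eta (rho s) (x * val t) = eta (rho s) x (+) (s == t).
  by move=> sx; rewrite etaM sx eta_gen.
have nb : (b == c) = false by apply/eqP.
have [x [bx cx]] := along_both cbc.
have [y [bY cY sb]] : exists y, [/\ along b y, along c y & eta (rho b) y = side b].
  have [e|ne] := eqVneq (eta (rho b) x) (side b); first by exists x.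
  exists (x * val b); split; [exact: along_mul | exact: along_mul |].
  by rewrite flip // eqxx addbT; move: ne; case: eta; case: side.
have [e|ne] := eqVneq (eta (rho c) y) (side c); first by exists y.
exists (y * val c); split; [exact: along_mul | exact: along_mul | |].
  by rewrite flip // nb addbF.
by rewrite flip // eqxx addbT; move: ne; case: eta; case: side.
Qed.

(** * Ping-pong from an inner chamber *)

Section InnerChamber.

Context (y : W) (inner_y : inner_chamber y).

Lemma crossed_along s x u :
  eta (rho s) (x * val u) != eta (rho s) x -> along s x /\ s = u.
Proof.
rewrite etaM eta_gen; case: (_ ^ _ =P _) => [e _|_]; last by rewrite addbF eqxx.
have [g sg] := al_conj s.
have su : s = u by apply: (@gen_conj_eq _ _ (g * x)); rewrite conjgM -sg.
by rewrite /along e su.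
Qed.

(** Follow a gallery from [y], which is on both chosen sides. A step crossing one of the walls runs
    along it, and there [sideP] puts the chamber on the chosen side of the other. *)
Lemma sides_cover s t x : ~ commute (val s) (val t) ->
  eta (rho s) x = side s \/ eta (rho t) x = side t.
Proof.
move=> nc; have nc' : ~ commute (val t) (val s) by move=> /commute_sym.
have [w] := ev_surj (y^-1 * x) => wE.
have {wE} -> : x = y * ev w by rewrite wE mulVKg.
elim/last_ind: w => [|w u IH]; first by left; rewrite mulg1.
rewrite -cats1 ev_cat /= mulg1 mulgA; set z := y * ev w in IH *.
have [es|/crossed_along [sz su]] :=
  eqVneq (eta (rho s) (z * val u)) (eta (rho s) z);
have [et|/crossed_along [tz tu]] :=
  eqVneq (eta (rho t) (z * val u)) (eta (rho t) z).
- by rewrite es et.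
- by left; rewrite es; exact: sideP tz.
- by right; rewrite et; exact: sideP sz.
- by case: nc; rewrite su tu.
Qed.

(* Ping-pong: the chambers [al x * y] are placed with respect to the walls of
   the reflections [rho s] as the [x] are with respect to those of the [s]. *)
Lemma ping_pong x s : eta (rho s) (al x * y) = side s (+) eta (val s) x.
Proof.
elim/descent_ind: x s => [|t x tx IH] s.
  by rewrite al1 mul1g eta1 addbF.
rewrite alM -mulgA.
have [cst|ncst] := pselect (commute (val s) (val t)).
  have [<-|nst] := pselect (s = t).
    by rewrite eta_rho IH eta_gen_mul addbN.
  have crst := (commute_al _ _).2 cst.
  rewrite (etaM _ (rho t)) (etaM _ (val t)) eta_gen !commute_conjg // IH.
  have -> : eta (rho s) (rho t) = false.
    have [h th] := al_conj t; move: crst; rewrite th => /eta_commute_refl ->.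
    by rewrite -th; apply/eqP => /(bij_inj al_bij) /val_inj.
  by case: (val s =P val t) => // /val_inj.
(* [t] is not a left descent of [x], so [al x * y] is on the chosen side of the wall of [rho t], and
   reflecting takes it off; [sides_cover] then decides the side for [s]. *)
have t_out : eta (rho t) (rho t * (al x * y)) <> side t.
  rewrite eta_rho IH; move: tx; rewrite eta_gen_mul => /negPf ->.
  by case: side.
have [->|/t_out//] := sides_cover (rho t * (al x * y)) ncst.
case: (boolP (eta (val s) _)) => [sx|_]; last by rewrite addbF.
by case: ncst; apply: descents_commute sx tx.
Qed.

(** By surjectivity the neighbour [y * val s] is some [al x * y]. A left descent [t] of [x] gives,
    by ping-pong, a wall between [y] and this neighbour, which can only be that of [rho s]. *)
Lemma inner_chamber_along s : along s y.
Proof.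
have [al' _ al'K] := al_bij.
set x := al' (val s ^ y^-1).
have xy : al x * y = y * val s by rewrite al'K conjgC conjgKV.
have [x1|[t tx]] : x = 1 \/ exists t, eta (val t) x.
  by elim/descent_ind: x {xy} => [|t x tx _]; [left | right; exists t].
- have s1 : val s = 1 by apply: (mulgI y); rewrite -xy x1 al1 mul1g mulg1.
  by have := eta_gen 1 s; rewrite s1 eqxx eta1.
- have [|ty <- //] := @crossed_along t y s.
  by rewrite -xy ping_pong tx inner_y; case: side.
Qed.

End InnerChamber.

Lemma special_inner : (exists b c, E b c) -> exists g, al = (fun x => x ^ g).
Proof.
move=> /inner_chamber_exists [y /inner_chamber_along al_y].
exists y^-1; apply/funext => x; have [w <-] := ev_surj x.
elim: w => [|s w IH] /=; first by rewrite al1 conj1g.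
by rewrite alM IH conjMg -{2}(al_y s) conjgK.
Qed.

End SpecialAutomorphism.

End RightAngledCoxeterGroup.

Theorem theorem2p19 (W : groupType) (S : set W)
  (hWS : right_angled_Coxeter_system S)
  (hstar : star_connected (@Coxeter_graph W S))
  (htri : triangle_free (@Coxeter_graph W S))
  (hP4 : contains_P4 (@Coxeter_graph W S)) :
  Spe S = Inn W.
Proof.
have [C [C_neq presW]] := hWS.
apply/seteqP; split=> [f [[f_bij fM] f_conj]|_ [g ->]].
  have f_conj' (s : S) : exists g, f (val s) = val s ^ g.
    exact: f_conj (set_valP s).
  have [a [b [_ [_ [_ [_ [ab _ _]]]]]]] := hP4.
  by apply: (special_inner C_neq presW fM f_bij f_conj' hstar htri); exists a, b.
split; last by move=> s _; exists g.
split; last by move=> x y; exact: conjMg.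
by exists (fun x => x ^ g^-1) => x; rewrite ?conjgK ?conjgKV.
Qed.
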